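(* $n(2,4)=9$, $n(2,5)\le 14$, $n(2,6)\le 21$, $n(2,7)\le 29$, $n(2,8)\le 45$, $n(2,9)\le 70$, and $n(2,10)\le 95$.
   Context: A standard box in $\mathbb{R}^d$ is a set $K=K_1\times\cdots\times K_d$ where each $K_i\subseteq\mathbb{R}$ is a closed interval. A finite family of $d$-dimensional standard boxes in $\mathbb{R}^d$ is called $k$-neighborly if the dimension of the intersection of any two distinct members is in $\{d-k,d-k+1,\ldots,d-1\}$ (in particular the intersection is nonempty). For positive integers $1\le k\le d$, $n(k,d)$ is the maximum number of members of a $k$-neighborly family of $d$-dimensional standard boxes in $\mathbb{R}^d$. *)

(* Defs.v *)
From mathcomp Require Import all_boot all_order all_algebra.
From mathcomp Require Import all_classical all_reals all_analysis.

Set Implicit Arguments.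
Unset Strict Implicit.
Unset Printing Implicit Defensive.

Import Order.TTheory GRing.Theory Num.Theory.

Local Open Scope classical_set_scope.
Local Open Scope card_scope.
Local Open Scope ring_scope.

Definition closed_interval (R : realType) (I : set R) : Prop :=
  exists a b : R, a <= b /\ I = `[a, b]%classic.

Definition standard_box (R : realType) (d : nat) (K : set 'rV[R]_d) : Prop :=
  exists I : 'I_d -> set R,
    (forall i, closed_interval (I i)) /\
    K = [set x | forall i, I i (x ord0 i)].

Definition affine_hull (R : realType) (d : nat) (S : set 'rV[R]_d) :
    set 'rV[R]_d :=
  [set x | exists (m : nat) (c : 'I_m -> R) (s : 'I_m -> 'rV[R]_d),
     [/\ forall i, S (s i), \sum_i c i = 1 & x = \sum_i c i *: s i]].

(* The affine hull of S is a translate of a linear subspace of dimension j;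
   the empty set has no dimension. *)
Definition has_dim (R : realType) (d : nat) (S : set 'rV[R]_d) (j : nat) :
    Prop :=
  exists (p : 'rV[R]_d) (V : {vspace 'rV[R]_d}),
    \dim V = j /\ affine_hull S = [set x | x - p \in V].

(* Meant for 1 <= k <= d, so that the subtractions are exact. *)
Definition neighborly (R : realType) (k d : nat) (F : set (set 'rV[R]_d)) :
    Prop :=
  [/\ finite_set F,
      forall K, F K -> standard_box K /\ has_dim K d
    & forall K L, F K -> F L -> K <> L ->
        exists j : nat, (d - k <= j <= d - 1)%N /\ has_dim (K `&` L) j].

(* n(k,d) = m. This is a relation rather than a function so that no default
   value stands in for a maximum that has not been shown to exist. *)
Definition max_neighborly (R : realType) (k d m : nat) : Prop :=
  (exists F : set (set 'rV[R]_d), neighborly k F /\ F #= `I_m) /\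
  (forall (F : set (set 'rV[R]_d)) (m' : nat),
     neighborly k F -> F #= `I_m' -> (m' <= m)%N).

(* Main.v *)
Require Import Defs.
From mathcomp Require Import all_boot all_order all_algebra.
From mathcomp Require Import all_classical all_reals all_analysis.
From mathcomp Require Import ring lra zify.

Set Implicit Arguments.
Unset Strict Implicit.
Unset Printing Implicit Defensive.

Import Order.TTheory GRing.Theory Num.Theory.

(** Pairwise intersecting intervals share a point p, so on each axis a box is
    recorded by a letter: 0 if p is its right end, 1 if p is its left end, * if
    p is interior.  Two boxes of the family touch along an axis exactly when one
    letter is 0 and the other 1, so a k-neighborly family is a set of n words in
    {0,1,*}^d, any two of which clash in 1 to k positions.  The letters 0, 1, *
    are encoded as [Some false], [Some true], [None].

    Let k = 2, let f bound the size of such codes in dimension d - 1, let C be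
    the total number of stars, and let S be the sum over all ordered pairs of
    the number of clashes.  With a_i zeros and b_i ones in position i:
    - the words without a 1 (or a 0) at i form a code in dimension d - 1, so
      a_i, b_i >= n - f, and (a_i - (n - f)) (b_i - (n - f)) >= 0 sums over i to
      2 (n - f) (d f - C) <= S;
    - if D is the clash matrix and J the all-one matrix, then 2 J - D has trace
      2 n and is a difference of two positive semidefinite matrices, the first
      of rank at most d + 1; so its squared Frobenius norm, which is
      2 n (n + 1) - S since its off-diagonal entries are 0 or 1, is at least
      (2 n)^2 / (d + 1);
    - the subcubes of {0,1}^d described by the words are disjoint, which
      bounds C from above.
    For n one more than the claimed bound these three inequalities are
    incompatible, and the bounds follow one from the other for d = 3, ..., 10. *)

(** * Codes *)

Definition differ (x y : option bool) : bool :=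
  if (x, y) is (Some a, Some b) then a (+) b else false.

Definition word_dist d (u v : 'I_d -> option bool) : nat :=
  \sum_i differ (u i) (v i).

Definition code k d (T : finType) (w : T -> 'I_d -> option bool) : Prop :=
  forall s t, s != t -> 0 < word_dist (w s) (w t) <= k.

Definition code_bound k d f : Prop :=
  forall (T : finType) (w : T -> 'I_d -> option bool), code k w -> #|T| <= f.

Definition stars d (u : 'I_d -> option bool) : nat := \sum_i (u i == None).

Lemma code_volume k d (T : finType) (w : T -> 'I_d -> option bool) :
  code k w -> \sum_t 2 ^ stars (w t) <= 2 ^ d.
Proof.
(* [g t i b] is 1 when the subcube of [w t] has points with bit [b] at [i], so the product over [i]
   is the indicator of that subcube. *)
move=> wP; pose g t i b : nat := ~~ differ (w t i) (Some b).
have cube t : 2 ^ stars (w t) = \sum_(x : {ffun 'I_d -> bool}) \prod_i g t i (x i).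
  rewrite -(bigA_distr_bigA (g t)) /stars expn_sum; apply: eq_bigr => i _.
  by rewrite big_bool /g; case: (w t i) => [[]|].
have memE t (x : {ffun 'I_d -> bool}) :
    \prod_i g t i (x i) = [forall i, ~~ differ (w t i) (Some (x i))].
  have [tx|] := boolP [forall i, ~~ differ (w t i) (Some (x i))].
    by rewrite big1 // => i _; rewrite /g (forallP tx).
  rewrite negb_forall => /existsP[i /negPn ti].
  by rewrite (bigD1 i) //= /g ti.
rewrite (eq_bigr _ (fun t _ => cube t)) exchange_big /=.
have -> : 2 ^ d = \sum_(x : {ffun 'I_d -> bool}) 1.
  by rewrite sum1_card card_ffun card_bool card_ord.
apply: leq_sum => x _ /=.
rewrite (eq_bigr _ (fun t _ => memE t x)).
have [s sx|no] := pickP (fun s => [forall i, ~~ differ (w s i) (Some (x i))]);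
  last by rewrite big1 // => s _; rewrite no.
rewrite (bigD1 s) //= sx big1 // => t ts.
apply/eqP; rewrite eqb0; apply/negP => tx.
have /andP[] := wP _ _ ts; rewrite lt0n => /negP neq _; apply: neq; apply/eqP.
rewrite /word_dist big1 // => i _.
move: (forallP sx i) (forallP tx i); rewrite /differ.
by case: (w t i) (w s i) => [[]|] [[]|] //; case: (x i).
Qed.

(** Linearizes the volume bound: the line [2 ^ e * (1 + c - e)] meets [2 ^ c] at [e] and [e + 1]
    and, by convexity, lies below it at all other naturals. The choice of [e] is left open. *)
Lemma code_stars k d (T : finType) (w : T -> 'I_d -> option bool) e :
  code k w ->
  2 ^ e * (#|T| + \sum_t stars (w t)) <= 2 ^ d + 2 ^ e * e * #|T|.
Proof.
move=> /code_volume vol.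
have tangent c : 2 ^ e * (1 + c) <= 2 ^ c + 2 ^ e * e.
  have [ce|ec] := leqP e c.
    rewrite -(subnK ce) expnD addnA mulnDr leq_add2r mulnC leq_mul2r add1n.
    by rewrite ltn_expl ?orbT.
  by apply: leq_trans (leq_addl _ _); rewrite leq_mul2l add1n ec orbT.
have {tangent} : \sum_(t : T) 2 ^ e * (1 + stars (w t))
    <= \sum_(t : T) (2 ^ stars (w t) + 2 ^ e * e) by apply: leq_sum.
rewrite -big_distrr /= !big_split /= sum1_card sum_nat_const.
by move=> le; apply: leq_trans le _; rewrite mulnC leq_add2r.
Qed.

Lemma code_inj k d (S T : finType) (h : S -> T) (w : T -> 'I_d -> option bool) :
  injective h -> code k w -> code k (w \o h).
Proof. by move=> hI wP s t st; apply: wP; rewrite (inj_eq hI). Qed.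

(* Deleting a coordinate in which no two words differ changes no distance. *)
Lemma code_facet k d f (T : finType) (w : T -> 'I_d.+1 -> option bool) i b :
  code k w -> code_bound k d f -> #|[pred t | w t i != Some b]| <= f.
Proof.
move=> wP df; rewrite -card_sig.
have same x y : x != Some b -> y != Some b -> differ x y = false.
  by case: b x y => [] [[]|] [[]|].
pose w' (t : {t | w t i != Some b}) j := w (val t) (lift i j).
apply: (df _ w') => s t st; have := wP (val s) (val t).
rewrite (inj_eq val_inj) => /(_ st); rewrite /word_dist (bigD1_ord i) //=.
by rewrite (same _ _ (valP s) (valP t)).
Qed.

Lemma code_facets k d f (T : finType) (w : T -> 'I_d.+1 -> option bool) :
  code k w -> code_bound k d f -> f <= #|T| ->
  2 * (#|T| - f) * (d.+1 * f)
    <= 2 * (#|T| - f) * \sum_t stars (w t) + \sum_s \sum_t word_dist (w s) (w t).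
Proof.
move=> wP df fT.
pose a i x := \sum_t (w t i == x).
have starsE : \sum_t stars (w t) = \sum_i a i None by rewrite exchange_big.
have distE : \sum_s \sum_t word_dist (w s) (w t)
    = \sum_i 2 * (a i (Some false) * a i (Some true)).
  rewrite (eq_bigr _ (fun s _ => exchange_big _ _ _ _ _ _)) exchange_big /=.
  apply: eq_bigr => i _.
  rewrite mul2n -addnn {1}mulnC !big_distrlr /= -big_split; apply: eq_bigr => s _.
  rewrite -big_split; apply: eq_bigr => t _.
  by case: (w s i) (w t i) => [[]|] [[]|].
have -> : d.+1 * f = \sum_(i < d.+1) f by rewrite sum_nat_const card_ord.
rewrite starsE distE !big_distrr /= -big_split.
apply: leq_sum => i _ /=.
have tot : a i None + a i (Some false) + a i (Some true) = #|T|.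
  rewrite -!big_split -sum1_card; apply: eq_bigr => t _ /=.
  by case: (w t i) => [[]|].
have fac b : a i (Some b) >= #|T| - f.
  have := code_facet i b wP df.
  rewrite -(cardC [pred t | w t i != Some b]) leq_subLR => le.
  apply: leq_add le _; rewrite -sum1_card big_mkcond leq_eqVlt.
  apply/orP; left; apply/eqP/eq_bigr => t _.
  by rewrite !inE negbK; case: eqP.
move: (fac true) (fac false) tot (subKn fT); move: (#|T| - f) => m.
move=> /subnK <- /subnK <- <- <-; rewrite addnA addnK.
(* With [x] and [y] the excesses of the two letter counts over [m], the two sides differ by
   [2 * x * y]. *)
move: (a i None) (_ - m) (_ - m) => c x y.
rewrite !(mulnDr, mulnDl, mulnA); lia.
Qed.

(** * Orthogonal projections *)

Section Projection.
Local Open Scope ring_scope.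

Lemma mxtrace_mulmx_tr_ge0 (F : realFieldType) m n (A : 'M[F]_(m, n)) :
  0 <= \tr (A *m A^T).
Proof.
apply: sumr_ge0 => i _; rewrite mxE; apply: sumr_ge0 => j _.
by rewrite mxE -expr2 sqr_ge0.
Qed.

Lemma mxtrace_mulmx_tr_eq0 (F : realFieldType) m n (A : 'M[F]_(m, n)) :
  \tr (A *m A^T) = 0 -> A = 0.
Proof.
have sq i : 0 <= (A *m A^T) i i.
  by rewrite mxE; apply: sumr_ge0 => j _; rewrite mxE -expr2 sqr_ge0.
move=> /eqP; rewrite /mxtrace psumr_eq0 // => /allP A0.
apply/matrixP => i j; rewrite mxE.
have := A0 i; rewrite mem_index_enum => /(_ isT) /=.
rewrite mxE psumr_eq0; last by move=> l _; rewrite mxE -expr2 sqr_ge0.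
move=> /allP /(_ j); rewrite mem_index_enum => /(_ isT) /=.
by rewrite mxE -expr2 sqrf_eq0 => /eqP.
Qed.

(** Gram-Schmidt without normalization: no square roots are taken, so the field may be [rat]. The
    trace of a projection is its rank, whence the last bound. *)
Lemma orthogonal_projection (F : realFieldType) n (s : seq 'cV[F]_n) :
  exists Q : 'M[F]_n, [/\ Q^T = Q, Q *m Q = Q, {in s, forall x, Q *m x = x}
                        & \tr Q <= (size s)%:R].
Proof.
elim: s => [|x s [Q [QT QQ Qs trQ]]].
  by exists 0; rewrite trmx0 mulmx0 mxtrace0; split.
pose y := x - Q *m x.
have Qy : Q *m y = 0 by rewrite mulmxBr mulmxA QQ subrr.
have yQ : y^T *m Q = 0 by rewrite -[Q]QT -trmx_mul Qy trmx0.
have yx : y^T *m x = y^T *m y by rewrite {3}/y mulmxBr mulmxA yQ mul0mx subr0.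
pose c := \tr (y *m y^T).
have yyE : y^T *m y = c%:M by rewrite [LHS]mx11_scalar /c mxtrace_mulC trace_mx11.
have [c0|c_neq0] := eqVneq c 0.
  exists Q; split => //.
    move=> z; rewrite inE => /predU1P[->|/Qs//].
    by apply/esym/eqP; rewrite -subr_eq0; apply/eqP/mxtrace_mulmx_tr_eq0.
  by apply: le_trans trQ _; rewrite ler_nat.
exists (Q + c^-1 *: (y *m y^T)); split.
- by rewrite linearD linearZ /= trmx_mul trmxK QT.
- rewrite mulmxDl !mulmxDr QQ -!scalemxAr -!scalemxAl !mulmxA Qy mul0mx scaler0.
  rewrite -[y *m _ *m _]mulmxA yQ mulmx0 scaler0 addr0 add0r.
  by rewrite -[y *m _ *m y]mulmxA yyE mul_mx_scalar -scalemxAl !scalerA divfK.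
- move=> z; rewrite mulmxDl -scalemxAl -mulmxA inE => /predU1P[->|zs].
    by rewrite yx yyE mul_mx_scalar scalerA mulVf // scale1r addrC subrK.
  have yz : y^T *m z = 0 by rewrite -(Qs _ zs) mulmxA yQ mul0mx.
  by rewrite yz mulmx0 scaler0 addr0 Qs.
- by rewrite linearD linearZ /= -/c mulVf // -addn1 natrD lerD2r.
Qed.

(** Pythagoras: the difference is the squared norm of [x - Q *m x]. *)
Lemma projection_norm_le (F : realFieldType) n (Q : 'M[F]_n) (x : 'cV[F]_n) :
  Q^T = Q -> Q *m Q = Q -> \tr (Q *m (x *m x^T)) <= \tr (x *m x^T).
Proof.
move=> QT QQ; rewrite -subr_ge0.
suff -> : \tr (x *m x^T) - \tr (Q *m (x *m x^T)) =
          \tr ((x - Q *m x) *m (x - Q *m x)^T) by apply: mxtrace_mulmx_tr_ge0.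
rewrite linearB /= trmx_mul QT mulmxBl !mulmxBr !linearB /= !mulmxA.
rewrite [\tr (x *m x^T *m Q)]mxtrace_mulC [\tr (_ *m Q)]mxtrace_mulC !mulmxA QQ.
by rewrite subrr subr0.
Qed.

(** Cauchy-Schwarz for the trace inner product of [Q] and [M], since [\tr (Q *m Q) = \tr Q]. *)
Lemma mxtrace_projection_sqr (F : realFieldType) n (Q M : 'M[F]_n) :
  Q^T = Q -> Q *m Q = Q -> M^T = M -> (\tr (Q *m M)) ^+ 2 <= \tr Q * \tr (M *m M).
Proof.
move=> QT QQ MT.
have norm c : 0 <= \tr (M *m M) - c *+ 2 * \tr (Q *m M) + c ^+ 2 * \tr Q.
  have sym : (M - c *: Q)^T = M - c *: Q by rewrite linearB linearZ /= QT MT.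
  have := mxtrace_mulmx_tr_ge0 (M - c *: Q); rewrite sym mulmxBl !mulmxBr.
  rewrite -!scalemxAr -!scalemxAl QQ.
  rewrite !linearB !linearZ /= [\tr (M *m Q)]mxtrace_mulC.
  by set a := \tr _; set b := \tr _; set e := \tr _; congr (_ <= _); ring.
have [trQ0|trQ0] := eqVneq (\tr Q) 0.
  have Q0 : Q = 0 by apply: mxtrace_mulmx_tr_eq0; rewrite QT QQ.
  by rewrite Q0 mul0mx mxtrace0 mul0r expr2 mul0r.
have trQ : 0 < \tr Q by rewrite lt_neqAle eq_sym trQ0 -QQ -{2}QT mxtrace_mulmx_tr_ge0.
(* This [c] minimizes the squared norm of [M - c *: Q]. *)
have := mulr_ge0 (ltW trQ) (norm (\tr (Q *m M) / \tr Q)).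
rewrite -[\tr (Q *m M) ^+ 2 <= _]subr_ge0.
by set a := \tr _; set b := \tr _; set e := \tr _; congr (_ <= _); field.
Qed.

End Projection.

(** * Upper bounds for codes of diameter two *)

(** For signs x and y, |xy| - xy is twice the clash indicator; this splits the clash matrix of an
    axis into two rank-one terms. *)
Definition sign_of (x : option bool) : rat :=
  (if x is Some b then (-1) ^+ b else 0)%R.

(** Eigenvalues are avoided by a projection [Q] fixing [one] and all [x i]: it keeps the trace of
    the positive part of [M] and does not raise that of the negative part, so [\tr (Q *m M)] is at
    least the trace [2 * n] of [M]. Cauchy-Schwarz concludes. *)
Lemma code2_dist d n (w : 'I_n -> 'I_d -> option bool) :
  code 2 w ->
  4 * n ^ 2 + d.+1 * \sum_s \sum_t word_dist (w s) (w t)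
    <= d.+1 * (2 * n * n.+1).
Proof.
move=> wP; set S := \sum_s _.
pose M : 'M[rat]_n := (\matrix_(s, t) (2 - (word_dist (w s) (w t))%:R))%R.
pose one : 'cV[rat]_n := const_mx 1%R.
pose e i : 'cV[rat]_n := (\col_t (w t i != None)%:R)%R.
pose x i : 'cV[rat]_n := (\col_t sign_of (w t i))%R.
have MT : (M^T = M)%R.
  apply/matrixP => s t; rewrite !mxE; congr (_ - _%:R)%R.
  by apply: eq_bigr => i _; case: (w s i) (w t i) => [[]|] [[]|].
have ME : (M = 2 *: (one *m one^T)
             - 2^-1 *: \sum_i (e i *m (e i)^T - x i *m (x i)^T))%R.
  apply/matrixP => s t; rewrite !mxE big_ord1 !mxE mulr1 mulr1; congr (_ - _)%R.
  rewrite summxE /word_dist natr_sum mulr_sumr; apply: eq_bigr => i _.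
  rewrite !mxE !big_ord1 !mxE /differ /sign_of.
  by case: (w s i) (w t i) => [[]|] [[]|]; rewrite /= ?expr1 ?expr0; lra.
have [Q [QT QQ Qfix trQ]] := orthogonal_projection (one :: codom x).
rewrite /= size_codom card_ord in trQ.
have trone : (\tr (one *m one^T) = n%:R)%R.
  rewrite /mxtrace (eq_bigr (fun=> 1%R)) ?sumr_const ?card_ord // => i _.
  by rewrite !mxE big_ord1 !mxE mulr1.
have trex i : (\tr (e i *m (e i)^T) = \tr (x i *m (x i)^T))%R.
  apply: eq_bigr => t _; rewrite !mxE !big_ord1 !mxE /sign_of.
  by case: (w t i) => [[]|]; rewrite /= ?expr1 ?expr0; lra.
have trQM : (2 * n%:R <= \tr (Q *m M))%R.
  rewrite ME mulmxBr -!scalemxAr linearB !linearZ /= mulmxA.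
  rewrite Qfix ?mem_head // trone -[leLHS]subr0 lerD2l lerN2.
  rewrite pmulr_rle0 // mulmx_sumr linear_sum sumr_le0 // => i _.
  rewrite mulmxBr linearB /= [X in (_ - \tr X)%R]mulmxA Qfix; last first.
    by rewrite inE codom_f orbT.
  by rewrite subr_le0 -trex projection_norm_le.
(* Off the diagonal an entry of [M] is 0 or 1, its own square; on the diagonal it is 2, with square
   2 + 2. *)
have trMM : (\tr (M *m M) = (2 * n * n.+1)%:R - S%:R)%R.
  have -> : (\tr (M *m M) =
      \sum_s \sum_t (2 + (s == t)%:R * 2 - (word_dist (w s) (w t))%:R))%R.
    apply: eq_bigr => s _; rewrite mxE; apply: eq_bigr => t _.
    rewrite -{2}MT !mxE; have [<-|/wP] := eqVneq s t.
      have -> : word_dist (w s) (w s) = 0.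
        by rewrite /word_dist big1 // => i _; case: (w s i) => [[]|].
      by rewrite /=; lra.
    by case: (word_dist _ _) => [|[|[|m]]] //= _; lra.
  rewrite (eq_bigr (fun s => (2 * n.+1)%:R - (\sum_t word_dist (w s) (w t))%:R)%R).
    rewrite sumrB sumr_const card_ord -natr_sum; congr (_ - _)%R.
    by rewrite -mulrnA; congr (_%:R)%R; lia.
  move=> s _; rewrite sumrB big_split /= sumr_const card_ord -mulr_suml.
  rewrite (bigD1 s) //= eqxx big1 => [|t /negbTE]; last by rewrite eq_sym => ->.
  by rewrite natr_sum; congr (_ - _)%R; rewrite natrM -natr1 -mulr_natr; ring.
have nn : (0 <= 2 * n%:R :> rat)%R by rewrite mulr_ge0.
have : ((2 * n%:R) ^+ 2 <= (d.+1)%:R * ((2 * n * n.+1)%:R - S%:R) :> rat)%R.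
  apply: le_trans (_ : _ <= (\tr (Q *m M)) ^+ 2)%R _.
    by rewrite lerXn2r // nnegrE // (le_trans nn).
  apply: le_trans (mxtrace_projection_sqr QT QQ MT) _.
  by rewrite trMM ler_wpM2r // -trMM -{2}MT mxtrace_mulmx_tr_ge0.
rewrite mulrBr lerBrDr -!natrM -natrX -natrD ler_nat.
by rewrite expnMn.
Qed.

(** A code that is too large contains one of exactly [g.+1] words. Once [n], [f] and [e] are
    numerals, the three inequalities are linear in [C] and [S]. *)
Lemma code2_bound_step d f g e :
  code_bound 2 d f -> f <= g ->
  (let n := g.+1 in
   forall C S,
   2 * (n - f) * (d.+1 * f) <= 2 * (n - f) * C + S ->
   4 * n ^ 2 + d.+2 * S <= d.+2 * (2 * n * n.+1) ->
   2 ^ e * (n + C) <= 2 ^ d.+1 + 2 ^ e * e * n -> False) ->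
  code_bound 2 d.+1 g.
Proof.
move=> df fg contra T w wP; rewrite leqNgt; apply/negP => gT.
pose h : 'I_g.+1 -> T := enum_val \o widen_ord gT.
have hI : injective h.
  by apply: inj_comp (@enum_val_inj _ _) _ => i j /(congr1 val) /= /val_inj.
have hP := code_inj hI wP; have cardI := card_ord g.+1.
apply: (contra (\sum_t stars ((w \o h) t))
               (\sum_s \sum_t word_dist ((w \o h) s) ((w \o h) t))).
- by have := code_facets hP df; rewrite cardI; apply; apply: leqW.
- exact: code2_dist hP.
- by have := code_stars e hP; rewrite cardI.
Qed.

Lemma code_bound_pow k d : code_bound k d (2 ^ d).
Proof.
move=> T w /code_volume; apply: leq_trans; rewrite -sum1_card.
by apply: leq_sum => t _; rewrite expn_gt0.
Qed.

Lemma code2_bounds :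
  [/\ code_bound 2 4 9, code_bound 2 5 14, code_bound 2 6 21 & code_bound 2 7 29]
  /\ [/\ code_bound 2 8 45, code_bound 2 9 70 & code_bound 2 10 95].
Proof.
(* The numeral passed at each step is [e], chosen with [2 ^ e <= 2 ^ d / n < 2 ^ e.+1] for the new
   dimension [d] and [n] one above the new bound; this gives the sharpest linear bound on the
   stars. *)
have b3 : code_bound 2 3 6.
  by apply (@code2_bound_step _ _ _ 0 (@code_bound_pow 2 2)) => //= C S; lia.
have b4 : code_bound 2 4 9 by apply (@code2_bound_step _ _ _ 0 b3) => //= C S; lia.
have b5 : code_bound 2 5 14 by apply (@code2_bound_step _ _ _ 1 b4) => //= C S; lia.
have b6 : code_bound 2 6 21 by apply (@code2_bound_step _ _ _ 1 b5) => //= C S; lia.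
have b7 : code_bound 2 7 29 by apply (@code2_bound_step _ _ _ 2 b6) => //= C S; lia.
have b8 : code_bound 2 8 45 by apply (@code2_bound_step _ _ _ 2 b7) => //= C S; lia.
have b9 : code_bound 2 9 70 by apply (@code2_bound_step _ _ _ 2 b8) => //= C S; lia.
have b10 : code_bound 2 10 95 by apply (@code2_bound_step _ _ _ 3 b9) => //= C S; lia.
by [].
Qed.

(** * Boxes *)

Section Boxes.
Local Open Scope classical_set_scope.
Local Open Scope ring_scope.

Definition box (R : realType) d (l u : 'rV[R]_d) : set 'rV[R]_d :=
  [set x | forall i, l 0 i <= x 0 i <= u 0 i].

Lemma standard_boxP (R : realType) d (K : set 'rV[R]_d) : standard_box K <->
  exists l u : 'rV[R]_d, (forall i, l 0 i <= u 0 i) /\ K = box l u.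
Proof.
split=> [[I [Iint ->]]|[l [u [lu ->]]]]; last first.
  exists (fun i => `[l 0 i, u 0 i]%classic); split.
    by move=> i; exists (l 0 i), (u 0 i).
  by apply/seteqP; split=> x /= xI i; have := xI i; rewrite /= in_itv.
have [a aP] := choice Iint; have [b abP] := choice aP.
exists (\row_i a i), (\row_i b i); split=> [i|]; first by rewrite !mxE; case: (abP i).
apply/seteqP; split=> x /= xI i; have := xI i; case: (abP i) => _ ->;
  by rewrite /= in_itv !mxE.
Qed.

Lemma boxI (R : realType) d (l u l' u' : 'rV[R]_d) :
  box l u `&` box l' u' =
  box (\row_i Num.max (l 0 i) (l' 0 i)) (\row_i Num.min (u 0 i) (u' 0 i)).
Proof.
apply/seteqP; split=> x /=.
  move=> [lu lu'] i; rewrite !mxE ge_max le_min.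
  by case/andP: (lu i) => -> ->; case/andP: (lu' i) => -> ->.
by move=> lu; split=> i; have := lu i; rewrite !mxE ge_max le_min;
  move=> /andP[/andP[? ?] /andP[? ?]]; apply/andP.
Qed.

Lemma has_dim_nonempty (R : realType) d (S : set 'rV[R]_d) j :
  has_dim S j -> exists x, S x.
Proof.
move=> [p [V [_ affS]]].
have : affine_hull S p by rewrite affS /= subrr mem0v.
move=> [[|m] [c [s [Ss c1 _]]]]; last by exists (s ord0).
by move: c1 => /eqP; rewrite big_ord0 eq_sym oner_eq0.
Qed.

(** The differences of points of an affine subspace determine its direction space. *)
Lemma has_dim_inj (R : realType) d (S : set 'rV[R]_d) j j' :
  has_dim S j -> has_dim S j' -> j = j'.
Proof.
move=> [p [V [<- SV]]] [p' [V' [<- SV']]].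
have sub (q q' : 'rV[R]_d) (W W' : {vspace 'rV[R]_d}) :
    [set x | x - q \in W] = [set x | x - q' \in W'] -> (W <= W')%VS.
  move=> /seteqP[WW' _]; apply/subvP => v vW.
  have qW' : q - q' \in W' by apply: WW'; rewrite /= subrr mem0v.
  have vqW' : v + q - q' \in W' by apply: WW'; rewrite /= addrK.
  have -> : v = v + q - q' - (q - q') by rewrite opprB addrA subrK addrK.
  exact: memvB.
by congr (\dim _); apply/eqP; rewrite eqEsubv (sub p p') -?SV ?(sub p' p) -?SV.
Qed.

Definition coord_space (R : realType) d (A : {set 'I_d}) : {vspace 'rV[R]_d} :=
  <<[seq delta_mx 0%R i | i <- enum 'I_d & i \in A]>>%VS.

Lemma free_delta_row (R : realType) d :
  free [seq delta_mx 0 i : 'rV[R]_d | i <- enum 'I_d].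
Proof.
rewrite /free size_map size_enum_ord; apply/eqP.
suff -> : <<[seq delta_mx 0%R i : 'rV[R]_d | i <- enum 'I_d]>>%VS = fullv.
  by rewrite dimvf; exact: mul1n.
apply/eqP; rewrite eqEsubv subvf; apply/subvP => x _.
rewrite [x]row_sum_delta memv_suml // => i _.
by rewrite memvZ // memv_span // map_f // mem_enum.
Qed.

Lemma dim_coord_space (R : realType) d (A : {set 'I_d}) :
  \dim (coord_space R A) = #|A|.
Proof.
suff /eqP -> : free [seq delta_mx 0 i : 'rV[R]_d | i <- enum 'I_d & i \in A].
  by rewrite size_map [RHS]cardE [in RHS]/enum_mem -enumT; congr size; apply: eq_filter.
apply: (@catl_free _ _ [seq delta_mx 0 i | i <- enum 'I_d & i \notin A]).
rewrite -map_cat (perm_free (perm_map _ (permEl (perm_filterC _ _)))).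
exact: free_delta_row.
Qed.

Lemma mem_coord_space (R : realType) d (A : {set 'I_d}) (x : 'rV[R]_d) :
  reflect (forall i, i \notin A -> x 0 i = 0) (x \in coord_space R A).
Proof.
apply: (iffP idP) => [|x0].
  rewrite -[coord_space R A]/(<<in_tuple _>>%VS) => /coord_span -> i iA.
  rewrite summxE big1 // => j _; rewrite mxE.
  have := mem_nth 0 (ltn_ord j); rewrite {2}/in_tuple /=.
  move=> /mapP[h]; rewrite mem_filter => /andP[hA _] ->.
  by rewrite mxE /= (_ : i == h = false) ?mulr0 //; apply: contraNF iA => /eqP ->.
rewrite [x]row_sum_delta memv_suml // => i _.
have [iA|iA] := boolP (i \in A); last by rewrite x0 // scale0r mem0v.
by rewrite memvZ // memv_span // map_f // mem_filter iA mem_enum.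
Qed.

Lemma box_has_dim (R : realType) d (l u : 'rV[R]_d) :
  (forall i, l 0 i <= u 0 i) ->
  has_dim (box l u) #|[set i | l 0 i < u 0 i]%SET|.
Proof.
move=> lu; set A := [set i | _]%SET; exists l, (coord_space R A).
split; first exact: dim_coord_space.
apply/seteqP; split=> x /=.
  move=> [m [c [s [sbox c1 ->]]]]; apply/mem_coord_space => i.
  rewrite inE -leNgt => ul; rewrite 2!mxE summxE.
  rewrite (eq_bigr (fun j => c j * l 0 i)) => [|j _].
    by rewrite -mulr_suml c1 mul1r subrr.
  rewrite mxE; congr (_ * _); apply/eqP; rewrite eq_le.
  by case/andP: (sbox j i) => -> /le_trans ->.
move=> /mem_coord_space xA.
(* For a degenerate side, [r i] is a division by zero, hence [0]. *)
pose r i := (x 0 i - l 0 i) / (u 0 i - l 0 i).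
pose corner i := l + (u 0 i - l 0 i) *: delta_mx 0 i.
(* Index [ord0] carries [l] with the weight that makes the sum 1; the index lifted from [i] carries
   the corner adjacent to [l] along axis [i]. *)
exists d.+1, (fun j => if unlift ord0 j is Some i then r i else 1 - \sum_i r i).
exists (fun j => if unlift ord0 j is Some i then corner i else l).
split.
- move=> j; case: (unlift ord0 j) => [i|] h /=; last by rewrite lexx lu.
  rewrite !mxE eqxx /=; have := lu h; case: eqP => [->|_]; rewrite ?mulr1 ?mulr0; lra.
- rewrite big_ord_recl unlift_none [X in _ + X](eq_bigr r) ?subrK // => i _.
  by rewrite liftK.
- rewrite big_ord_recl unlift_none.
  rewrite [X in _ + X](eq_bigr (fun i =>
    r i *: l + (x 0 i - l 0 i) *: delta_mx 0 i)) => [|i _].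
    rewrite big_split /= -scaler_suml addrA -scalerDl subrK scale1r.
    rewrite -[LHS](subrKC l); congr (_ + _).
    by rewrite [LHS]row_sum_delta; apply: eq_bigr => i _; rewrite !mxE.
  rewrite liftK scalerDr scalerA; congr (_ + _ *: _); rewrite /r.
  have [ul|ul] := eqVneq (u 0 i - l 0 i) 0; last by rewrite divfK.
  rewrite ul mulr0; have := xA i; rewrite !mxE => -> //.
  by rewrite inE -subr_gt0 ul ltxx.
Qed.

End Boxes.

(** * Neighborly families and codes *)

Section Neighborly.
Local Open Scope classical_set_scope.
Local Open Scope card_scope.
Local Open Scope ring_scope.

Definition side_letter (R : realType) (p a b : R) : option bool :=
  if b == p then Some false else if a == p then Some true else None.

(** The meet is degenerate exactly when some left end and some right end both equal [p]; as [a < b]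
    and [a' < b'], these ends belong to different intervals. *)
Lemma differ_side_letter (R : realType) (p a b a' b' : R) :
  a < b -> a' < b' -> a <= p <= b -> a' <= p <= b' ->
  differ (side_letter p a b) (side_letter p a' b')
  = ~~ (Num.max a a' < Num.min b b').
Proof.
move=> ab ab' /andP[ap pb] /andP[ap' pb']; rewrite /side_letter.
have ltE x y : x <= p -> p <= y -> (x < y) = ~~ ((x == p) && (y == p)).
  move=> xp py; rewrite lt_neqAle (le_trans xp py) andbT; congr (~~ _).
  apply/eqP/andP => [xy|[/eqP-> /eqP->] //].
  by rewrite -xy in py *; rewrite eq_le xp py.
rewrite gt_max !lt_min ab ab' andbT /= !ltE //; move: ab ab'; rewrite !ltE //.
by case: (a == p) (b == p) (a' == p) (b' == p) => [] [] [] [].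
Qed.

(** Helly's theorem on the line: the largest left end works. *)
Lemma common_point (R : realType) m (a b : 'I_m -> R) :
  (forall s t, a s <= b t) -> exists p, forall s, a s <= p <= b s.
Proof.
case: m a b => [|m] a b ab; first by exists 0 => -[].
have [s _ smax] := @Order.TotalTheory.arg_maxP _ _ _ ord0 xpredT a isT.
by exists (a s) => t; rewrite ab andbT; apply: smax.
Qed.

Lemma word_dist_add_card d (u v : 'I_d -> option bool) (A : {set 'I_d}) :
  (forall i, differ (u i) (v i) = (i \notin A)) -> (word_dist u v + #|A| = d)%N.
Proof.
move=> uv; rewrite -[RHS]card_ord -(cardC A) addnC; congr addn.
rewrite /word_dist (eq_bigr _ (fun i _ => congr1 nat_of_bool (uv i))).
rewrite -sum1_card [RHS]big_mkcond; apply: eq_bigr => i _.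
by rewrite inE; case: (i \in A).
Qed.

Lemma neighborly_code (R : realType) k d m (F : set (set 'rV[R]_d)) :
  (0 < d)%N -> neighborly k F -> F #= `I_m ->
  exists w : 'I_m -> 'I_d -> option bool, code k w.
Proof.
move=> d0 [_ Fbox Fdim] /card_esym /card_set_bijP[K0 [K0F K0inj _]].
have [K KF Kinj] : exists2 K : 'I_m -> set 'rV[R]_d,
    forall s, F (K s) & injective K.
  exists (K0 \o val) => [s|s t /= st]; first by apply: K0F => /=.
  by apply/val_inj/K0inj; rewrite ?inE /=.
have /choice[l /choice[u lu]] (s : 'I_m) : exists l u : 'rV[R]_d,
    (forall i, l 0 i < u 0 i) /\ K s = box l u.
  have [/standard_boxP[l [u [lu KE]]] Kd] := Fbox _ (KF s).
  exists l, u; split=> // i.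
  (* Full dimension forces every side to be nondegenerate. *)
  have := box_has_dim lu; rewrite -KE => /(has_dim_inj Kd) cardE.
  have /eqP/setP/(_ i) : [set i | l 0 i < u 0 i]%SET == [set: 'I_d]%SET.
    by rewrite eqEcard finset.subsetT cardsT card_ord -cardE leqnn.
  by rewrite !inE.
have {}Fdim (s t : 'I_m) : s != t -> exists j : nat,
    (d - k <= j <= d - 1)%N /\ has_dim (K s `&` K t) j.
  by move=> st; apply: Fdim => // /Kinj/eqP; apply/negP.
pose a (s t : 'I_m) : 'rV[R]_d := \row_i Num.max (l s 0 i) (l t 0 i).
pose b (s t : 'I_m) : 'rV[R]_d := \row_i Num.min (u s 0 i) (u t 0 i).
have KK s t : K s `&` K t = box (a s t) (b s t).
  by rewrite (lu s).2 (lu t).2 boxI.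
have meet s t : s != t -> forall i, a s t 0 i <= b s t 0 i.
  move=> /Fdim[j [_ /has_dim_nonempty[x]]]; rewrite KK => xab i.
  by case/andP: (xab i); apply: le_trans.
have /choice[p pP] i : exists p, forall s, l s 0 i <= p <= u s 0 i.
  apply: common_point => s t; have [->|/meet/(_ i)] := eqVneq s t.
    by rewrite ltW // (lu t).1.
  by rewrite !mxE ge_max !le_min => /andP[/andP[_ ->]].
exists (fun s i => side_letter (p i) (l s 0 i) (u s 0 i)) => s t st.
have [j [jd]] := Fdim _ _ st.
rewrite KK => /(has_dim_inj (box_has_dim (meet _ _ st))) jE.
rewrite -jE in jd; move: jd.
set A := [set i | _]%SET; set D := word_dist _ _ => jd.
have : (D + #|A| = d)%N.
  apply: word_dist_add_card => // i; rewrite inE !mxE.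
  by apply: differ_side_letter; rewrite ?(lu _).1.
(* [0 < d] makes [d - 1] exact, so that [D] is positive. *)
lia.
Qed.

(** The letters 0, 1, * become the intervals [-1, 0], [0, 1], [-1, 1], with common point 0. *)
Definition letter_lo (R : realType) (x : option bool) : R :=
  if x is Some true then 0 else -1.
Definition letter_hi (R : realType) (x : option bool) : R :=
  if x is Some false then 0 else 1.

Lemma letter_meet (R : realType) (x y : option bool) :
  let a := Num.max (letter_lo R x) (letter_lo R y) in
  let b := Num.min (letter_hi R x) (letter_hi R y) in
  a <= b /\ (a < b) = ~~ differ x y.
Proof.
by case: x y => [[]|] [[]|]; rewrite /= gt_max ge_max !lt_min !le_min;
  rewrite ?lexx ?ltxx ?ltr01 ?ler01 ?ltrN10 ?lerN10 ?(lt_trans (ltrN10 R) ltr01)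
    ?(le_trans (lerN10 R) ler01).
Qed.

Lemma code_neighborly (R : realType) k d m (w : 'I_m -> 'I_d -> option bool) :
  code k w ->
  exists F : set (set 'rV[R]_d), neighborly k F /\ F #= `I_m.
Proof.
move=> wP.
pose l s : 'rV[R]_d := \row_i letter_lo R (w s i).
pose u s : 'rV[R]_d := \row_i letter_hi R (w s i).
pose K s := box (l s) (u s).
have lu s i : l s 0 i < u s 0 i.
  by rewrite !mxE; case: (w s i) => [[]|] /=; lra.
have Kd s : has_dim (K s) d.
  have := box_has_dim (fun i => ltW (lu s i)).
  suff -> : #|[set i | l s 0 i < u s 0 i]%SET| = d by [].
  by rewrite -[RHS]card_ord -cardsT; apply: eq_card => i; rewrite !inE lu.
have KK s t : has_dim (K s `&` K t) (d - word_dist (w s) (w t))%N.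
  have meet i := letter_meet R (w s i) (w t i).
  rewrite boxI; set a := \row_i _; set b := \row_i _.
  have ab i : a 0 i <= b 0 i by rewrite !mxE; case: (meet i).
  have := box_has_dim ab; set A := [set i | _]%SET.
  suff dE : (word_dist (w s) (w t) + #|A| = d)%N by rewrite -[X in (X - _)%N]dE addKn.
  apply: word_dist_add_card => // i.
  by rewrite inE !mxE (meet i).2 negbK.
have Kinj : injective K.
  move=> s t Kst; apply/eqP; apply/negPn/negP => st.
  have := wP _ _ st; have := KK s t; rewrite Kst setIid => /(has_dim_inj (Kd t)).
  (* This bounds the distance by [d], so a positive distance lowers the dimension strictly. *)
  have : (word_dist (w s) (w t) + #|[set i | ~~ differ (w s i) (w t i)]%SET| = d)%N.
    by apply: word_dist_add_card => // i; rewrite inE negbK.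
  lia.
have cardF : K @` setT #= `I_m.
  apply: card_eq_trans (card_esym card_II).
  by apply: inj_card_eq => s t _ _; apply: Kinj.
exists (K @` setT); split=> //; split; first by exists m.
  move=> _ [s _ <-]; split=> //; apply/standard_boxP.
  by exists (l s), (u s); split=> // i; apply: ltW.
move=> _ _ [s _ <-] [t _ <-] Kst.
exists (d - word_dist (w s) (w t))%N; split=> //.
have /wP : s != t by apply: contra_notN Kst => /eqP ->.
lia.
Qed.

(** The attained sizes include 0, by the empty family, and are bounded by [f] through codes, so a
    largest one exists. *)
Lemma max_neighborly_le (R : realType) k d f : (0 < d)%N -> code_bound k d f ->
  exists n : nat, max_neighborly R k d n /\ (n <= f)%N.
Proof.
move=> d0 df.
pose P n := `[< exists F : set (set 'rV[R]_d), neighborly k F /\ F #= `I_n >].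
have P0 : exists n, P n.
  exists 0; apply/asboolP; apply: (@code_neighborly R k d 0 (fun _ _ => None)).
  by case.
have Pf n : P n -> (n <= f)%N.
  by move=> /asboolP[F [Fk /(neighborly_code d0 Fk)[w /df]]]; rewrite card_ord.
case: (ex_maxnP P0 Pf) => n Pn nmax; exists n; split; last exact: Pf.
split; first exact/asboolP.
by move=> F m Fk Fm; apply: nmax; apply/asboolP; exists F.
Qed.

(** Any two of 00, 01, 1* clash exactly once. Distances add under concatenation, so distinct pairs
    of these words clash once or twice. *)
Definition words9 : seq (seq (option bool)) :=
  let c := [:: [:: Some false; Some false]; [:: Some false; Some true];
               [:: Some true; None]] in
  [seq s ++ t | s <- c, t <- c].

Lemma code_words9 :
  code 2 (fun (s : 'I_9) (i : 'I_4) => nth None (nth [::] words9 s) i).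
Proof.
move=> [s sP] [t tP]; rewrite /word_dist !big_ord_recl big_ord0.
by do 9?[case: s sP => [|s] sP //]; do 9?[case: t tP => [|t] tP //].
Qed.

End Neighborly.

Theorem corollary1p6 (R : realType) :
  max_neighborly R 2 4 9 /\
  (exists n : nat, max_neighborly R 2 5 n /\ (n <= 14)%N) /\
  (exists n : nat, max_neighborly R 2 6 n /\ (n <= 21)%N) /\
  (exists n : nat, max_neighborly R 2 7 n /\ (n <= 29)%N) /\
  (exists n : nat, max_neighborly R 2 8 n /\ (n <= 45)%N) /\
  (exists n : nat, max_neighborly R 2 9 n /\ (n <= 70)%N) /\
  (exists n : nat, max_neighborly R 2 10 n /\ (n <= 95)%N).
Proof.
have [[b4 b5 b6 b7] [b8 b9 b10]] := code2_bounds.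
do ![split; last by do ?[split]; apply: max_neighborly_le].
split; first exact: code_neighborly code_words9.
by move=> F m Fk Fm; have [//|w /b4] := neighborly_code _ Fk Fm; rewrite card_ord.
Qed.
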